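(* Let $n\in\mathbb N$ and let $\Phi=\{\varphi_m\}_{m=1}^\infty$ be a family of nondecreasing continuous convex functions $\varphi_m:[0,\infty)\to\mathbb R$ such that for each $m\in\mathbb N$: ($i_1$) $\lim_{x\to+\infty}\varphi_m(x)/x=+\infty$; ($i_2$) for each $A>0$ there is a constant $C(m,A)>0$ with $\varphi_m(x)+A\ln(1+x)\le\varphi_{m+1}(x)+C(m,A)$ for all $x\ge0$; ($i_3$) there is a constant $a_m>0$ such that $\varphi_m(2x)\le\varphi_{m+1}(x)+a_m$ for all $x\ge 0$. Then $G(\Psi^* )=GS(\Phi^* )$ (equality of topological vector spaces).
   Context: $\|\cdot\|$ is the Euclidean norm on $\mathbb R^n$. For $\alpha\in\mathbb Z_+^n$, $|\alpha|=\alpha_1+\dots+\alpha_n$, $x^\alpha=x_1^{\alpha_1}\cdots x_n^{\alpha_n}$, $D^\alpha=\partial^{|\alpha|}/\partial x_1^{\alpha_1}\cdots\partial x_n^{\alpha_n}$. Functions on $\mathbb R^n$ are complex-valued. For a continuous $g:[0,\infty)\to\mathbb R$ with $g(x)/x\to+\infty$ as $x\to+\infty$, the Young conjugate is $g^*(x)=\sup_{y\ge0}(xy-g(y))$, $x\ge0$. Put $\psi_\nu(x)=\varphi_\nu(e^x)$ for $x\ge0$, $\Psi^*=\{\psi_\nu^*\}_{\nu=1}^\infty$, $\Phi^*=\{\varphi_\nu^*\}_{\nu=1}^\infty$. For $\nu\in\mathbb N$, $m\in\mathbb Z_+$ let $$G_m(\psi_\nu^* )=\Big\{f\in C^m(\mathbb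 R^n):\ \|f\|_{m,\psi_\nu^*}=\sup_{x\in\mathbb R^n,\ |\alpha|\le m,\ \beta\in\mathbb Z_+^n}\frac{|x^\beta(D^\alpha f)(x)|}{|\beta|!\,e^{-\psi_\nu^*(|\beta|)}}<\infty\Big\}.$$ $G(\psi_\nu^* )=\bigcap_{m=0}^\infty G_m(\psi_\nu^* )$ has the topology defined by the norms $\|\cdot\|_{m,\psi_\nu^*}$, $m\in\mathbb Z_+$, and $G(\Psi^* )=\bigcup_{\nu=1}^\infty G(\psi_\nu^* )$ has the (locally convex) inductive limit topology of the spaces $G(\psi_\nu^* )$. For $\nu\in\mathbb N$, $m\in\mathbb Z_+$ let $$GS_m(\varphi_\nu^* )=\Big\{f\in C^m(\mathbb R^n):\ q_{m,\nu}(f)=\sup_{x\in\mathbb R^n,\ |\alpha|\le m}\frac{|(D^\alpha f)(x)|}{e^{-\varphi_\nu^*(\|x\|)}}<\infty\Big\}.$$ $GS(\varphi_\nu^* )=\bigcap_{m\in\mathbb Z_+}GS_m(\varphi_\nu^* )$ has the topology defined by the norms $q_{m,\nu}$, $m\in\mathbb Z_+$, and $GS(\Phi^* )=\bigcup_{\nu\in\mathbb N}GS(\varphi_\nu^* )$ has the (locally convex) inductive limit topology of the spaces $GS(\varphi_\nu^* )$. *)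

(* Defs.v *)
From HB Require Import structures.
From mathcomp Require Import all_boot all_order all_algebra.
From mathcomp Require Import complex.
From mathcomp Require Import all_classical all_reals all_analysis.

Set Implicit Arguments.
Unset Strict Implicit.
Unset Printing Implicit Defensive.

Import Order.TTheory GRing.Theory Num.Theory.
Import numFieldNormedType.Exports.

Local Open Scope classical_set_scope.
Local Open Scope ring_scope.

(* Topologies on a linear subspace E of a fixed vector space V are given by
   their systems of open sets, a set system on V made of subsets of E. *)
Section InductiveLimits.
Context {K : numFieldType} {V : lmodType K}.

(* p takes values in \bar R for a real field R, whereas K may be R[i]. *)
Definition seminorm_topology {R : realType} (E : set V)
    (p : nat -> V -> \bar R) : set_system V :=
  [set U | U `<=` E /\ forall f, U f -> exists m (e : R), 0 < e /\
    forall g, E g -> (forall k, (k <= m)%N -> (p k (g - f)%R < e%:E)%E) -> U g].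

(* T makes E a locally convex space, not necessarily Hausdorff: it is the image of the topology of a
   tvsType (locally convex in this library) under a linear bijection onto E. *)
Definition locally_convex_topology (E : set V) (T : set_system V) : Prop :=
  exists (F : tvsType K) (i : {linear F -> V}),
    [/\ injective i, range i = E & T = [set i @` O | O in @open F]].

Definition is_topology (E : set V) (T : set_system V) : Prop :=
  [/\ forall U, T U -> U `<=` E, T E, setI_closed T &
      forall S : set (set V), S `<=` T -> T (\bigcup_(U in S) U)].

Definition continuous_inclusion (E' : set V) (T' T : set_system V) : Prop :=
  forall U, T U -> T' (U `&` E').

(* The finest locally convex topology on the union of the E nu for which all
   the inclusions of the E nu are continuous, as the supremum of all the
   locally convex topologies with this property (on a linear subspace such a
   supremum is again locally convex and makes the inclusions continuous). *)
Definition inductive_limit_topology (E : nat -> set V)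
    (T : nat -> set_system V) : set_system V :=
  smallest (is_topology (\bigcup_nu E nu))
    (\bigcup_(S in [set S | locally_convex_topology (\bigcup_nu E nu) S /\
                     forall nu, continuous_inclusion (E nu) (T nu) S]) S).

End InductiveLimits.

Section FunctionSpaces.
Context {R : realType} {n : nat}.
Implicit Types (f : 'rV[R]_n -> R[i]^o) (x : 'rV[R]_n).

Definition multi_index := {ffun 'I_n -> nat}.

Definition mi_size (a : multi_index) : nat := (\sum_i a i)%N.

Definition monomial x (b : multi_index) : R := \prod_i x 0 i ^+ b i.

(* The library norm on 'rV[R]_n is the sup norm. *)
Definition euclidean_norm x : R := Num.sqrt (\sum_i x 0 i ^+ 2).

Definition unit_vector (i : 'I_n) : 'rV[R]_n := delta_mx 0 i.

Definition re_part f : 'rV[R]_n -> R := fun x => complex.Re (f x).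
Definition im_part f : 'rV[R]_n -> R := fun x => complex.Im (f x).

Definition partial (i : 'I_n) f : 'rV[R]_n -> R[i]^o :=
  fun x => ('D_(unit_vector i) (re_part f) x
            +i* 'D_(unit_vector i) (im_part f) x)%C.

Definition has_partial (i : 'I_n) f : Prop :=
  forall x, derivable (re_part f) x (unit_vector i) /\
            derivable (im_part f) x (unit_vector i).

Fixpoint C_ (m : nat) f : Prop :=
  [/\ continuous (re_part f), continuous (im_part f) &
      if m is m'.+1 then forall i, has_partial i f /\ C_ m' (partial i f)
      else True].

(* D^a f = d_1^(a_1) (d_2^(a_2) (... d_n^(a_n) f)). *)
Definition D (a : multi_index) f : 'rV[R]_n -> R[i]^o :=
  foldr (fun i g => iter (a i) (partial i) g) f (enum 'I_n).

(* The real supremum is 0 by convention on sets without upper bound; this does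
   not occur for continuous g with g x / x --> +oo. *)
Definition young_conjugate (g : R -> R) : R -> R :=
  fun x : R => sup [set x * y - g y | y in [set y | 0 <= y]].

Definition exp_reparam (g : R -> R) : R -> R := fun x : R => g (expR x).

Definition G_norm (w : R -> R) (m : nat) f : \bar R :=
  ereal_sup [set z | exists x (a b : multi_index), (mi_size a <= m)%N /\
    z = (Normc.normc ((monomial x b)%:C%C * D a f x) /
         ((mi_size b)`!%:R * expR (- w (mi_size b)%:R)))%:E].

Definition G_ (w : R -> R) (m : nat) : set ('rV[R]_n -> R[i]^o) :=
  [set f | C_ m f /\ (G_norm w m f < +oo)%E].

Definition G (w : R -> R) : set ('rV[R]_n -> R[i]^o) := \bigcap_m G_ w m.

Definition G_topology (w : R -> R) : set_system ('rV[R]_n -> R[i]^o) :=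
  seminorm_topology (G w) (G_norm w).

Definition GS_norm (w : R -> R) (m : nat) f : \bar R :=
  ereal_sup [set z | exists x (a : multi_index), (mi_size a <= m)%N /\
    z = (Normc.normc (D a f x) / expR (- w (euclidean_norm x)))%:E].

Definition GS_ (w : R -> R) (m : nat) : set ('rV[R]_n -> R[i]^o) :=
  [set f | C_ m f /\ (GS_norm w m f < +oo)%E].

Definition GS (w : R -> R) : set ('rV[R]_n -> R[i]^o) := \bigcap_m GS_ w m.

Definition GS_topology (w : R -> R) : set_system ('rV[R]_n -> R[i]^o) :=
  seminorm_topology (GS w) (GS_norm w).

End FunctionSpaces.

(* Families (phi_nu)_{nu >= 1} are indexed from 0: phi nu stands for
   phi_{nu+1}. *)
Section Families.
Context {R : realType} (n : nat) (phi : nat -> R -> R).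

Definition Phi_conj (nu : nat) : R -> R := young_conjugate (phi nu).

Definition Psi_conj (nu : nat) : R -> R :=
  young_conjugate (exp_reparam (phi nu)).

Definition G_Psi : set ('rV[R]_n -> R[i]^o) := \bigcup_nu G (Psi_conj nu).

Definition G_Psi_topology : set_system ('rV[R]_n -> R[i]^o) :=
  inductive_limit_topology (fun nu => G (Psi_conj nu))
                           (fun nu => G_topology (Psi_conj nu)).

Definition GS_Phi : set ('rV[R]_n -> R[i]^o) := \bigcup_nu GS (Phi_conj nu).

Definition GS_Phi_topology : set_system ('rV[R]_n -> R[i]^o) :=
  inductive_limit_topology (fun nu => GS (Phi_conj nu))
                           (fun nu => GS_topology (Phi_conj nu)).

End Families.

Arguments G_Psi {R} n phi.
Arguments G_Psi_topology {R} n phi.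
Arguments GS_Phi {R} n phi.
Arguments GS_Phi_topology {R} n phi.

(* Main.v *)
(* Since [euclidean_norm x ^+ k] dominates the monomials of degree k and is
   dominated by n^k times the power [x_i ^+ k] of the largest coordinate, only
   radial weights matter. With s = e^y,
   e^(psi^*(k)) = sup_(s >= 1) s^k e^(- phi(s)).
   - GS(phi_nu^* ) is contained in G(psi_nu^* ) by the inequality
     (t s)^k / k! <= e^(t s) <= e^(phi^*(t) + phi(s)).
   - Conversely, a bound F (t s / n)^k / k! <= N e^(phi_nu(s)) for all k can be
     summed over k after replacing s by 2^j s with 2^j >= 2 n; (i3) absorbs
     this dilation into phi_(nu + j), whence F e^(t s) <= C N e^(phi_(nu+j)(s)).
   Both bounds hold for arbitrary functions in place of D^alpha f, so they
   compare the seminorms of differences too, and the two inductive systems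
   are cofinal in each other. *)
Require Import Defs.
From HB Require Import structures.
From mathcomp Require Import all_boot all_order all_algebra.
From mathcomp Require Import complex.
From mathcomp Require Import lra ring.
From mathcomp Require Import all_classical all_reals all_analysis.

Set Implicit Arguments.
Unset Strict Implicit.
Unset Printing Implicit Defensive.

Import Order.TTheory GRing.Theory Num.Theory.
Import numFieldNormedType.Exports.

Local Open Scope classical_set_scope.
Local Open Scope ring_scope.

(** * Estimates for Young conjugates of radial weights *)

Section YoungConjugate.
Context {R : realType}.
Implicit Types (g phi : R -> R) (t y u : R) (k : nat).

(** Boundedness of the set under [sup]: it excludes the default value 0 and makes
    [young_conjugate g] a true supremum. *)
Definition finite_conjugate g :=
  forall t, exists c, forall y, 0 <= y -> t * y - g y <= c.

Lemma young_conjugate_ge g t y :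
  finite_conjugate g -> 0 <= y -> t * y - g y <= young_conjugate g t.
Proof.
move=> /(_ t)[c gc] y0; apply: ub_le_sup; last by exists y.
by exists c => _ [z /= z0 <-]; exact: gc.
Qed.

Lemma young_conjugate_le g t M :
  (forall y, 0 <= y -> t * y - g y <= M) -> young_conjugate g t <= M.
Proof.
move=> gM; apply: ge_sup; first by exists (t * 0 - g 0); exists 0 => /=.
by move=> _ [y /= y0 <-]; exact: gM.
Qed.

Lemma expR_young_conjugate_le g t A B : 0 <= A ->
  (forall y, 0 <= y -> A * expR (t * y - g y) <= B) ->
  A * expR (young_conjugate g t) <= B.
Proof.
rewrite le_eqVlt => /predU1P[<- /(_ _ (lexx 0))|A0 AB]; first by rewrite !mul0r.
have B0 : 0 < B.
  by apply: lt_le_trans (AB 0 (lexx _)); rewrite mulr_gt0 ?expR_gt0.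
rewrite mulrC -ler_pdivlMr// -[leRHS]lnK ?posrE ?divr_gt0// ler_expR.
apply: young_conjugate_le => y y0.
rewrite -ler_expR lnK ?posrE ?divr_gt0// ler_pdivlMr// mulrC.
exact: AB.
Qed.

Lemma finite_conjugate_superlinear phi :
  (forall x y, 0 <= x -> x <= y -> phi x <= phi y) ->
  phi x / x @[x --> +oo] --> +oo -> finite_conjugate phi.
Proof.
move=> phi_nd phi_oo t.
(* Beyond [s] the ratio [phi y / y] exceeds [t], so the expression is negative; up to [|s|],
   monotonicity gives [- phi y <= - phi 0]. *)
have [s [_ sP]] := (cvgryPgt _).1 phi_oo t.
exists (`|t| * `|s| + `|phi 0|) => y y0.
have [sy|ys] := ltP `|s| y.
  have ygt0 : 0 < y by exact: le_lt_trans sy.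
  have := sP y (le_lt_trans (ler_norm s) sy).
  rewrite ltr_pdivlMr// -subr_lt0 => /ltW/le_trans; apply.
  by rewrite addr_ge0// mulr_ge0.
apply: lerD; last first.
  by rewrite -normrN; apply: le_trans (ler_norm _); rewrite lerN2 phi_nd.
apply: le_trans (ler_norm _) _; rewrite normrM ler_wpM2l// ger0_norm//.
Qed.

Lemma finite_conjugate_exp_reparam phi :
  finite_conjugate phi -> finite_conjugate (exp_reparam phi).
Proof.
move=> phi_fin t; have [c phic] := phi_fin `|t|; exists c => y y0.
apply: le_trans (phic _ (expR_ge0 y)); rewrite lerB//.
apply: le_trans (ler_wpM2r y0 (ler_norm t)) _; rewrite ler_wpM2l//.
by apply: le_trans (expR_ge1Dx y); rewrite lerDr.
Qed.

Lemma exprn_le_fact_expR u k : 0 <= u -> u ^+ k <= k`!%:R * expR u.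
Proof.
move=> u0; case: k => [|k].
  by rewrite expr0 mul1r (le_trans _ (expR_ge1Dx u))// lerDl.
rewrite mulrC -ler_pdivrMr ?ltr0n ?fact_gt0//.
by apply: le_trans (expR_ge1Dxn k u0); rewrite lerDr.
Qed.

(** The factor 2 makes the k-th Taylor term of [A * expR u] at most [B / 2 ^ k], and this geometric
    series sums to [2 * B]. *)
Lemma expR_le_of_powers A B u : 0 <= A -> 0 <= u ->
  (forall k, A * (2 * u) ^+ k <= B * k`!%:R) -> A * expR u <= 2 * B.
Proof.
move=> A0 u0 AB.
have [->|An0] := eqVneq A 0.
  by rewrite mul0r; have := AB 0; rewrite /= !mulr1; lra.
have {A0 An0} Agt0 : 0 < A by rewrite lt_def An0.
rewrite mulrC -ler_pdivlMr// /expR; apply: limr_le.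
  exact: is_cvg_series_exp_coeff.
apply: nearW => K; rewrite ler_pdivlMr// mulrC /series /= mulr_sumr.
have B0 : 0 <= B by have := AB 0%N; rewrite /= !mulr1; lra.
(* The right-hand side is the exact partial sum of the [B / 2 ^ k], which lets the induction
   close. *)
suff : \sum_(0 <= k < K) A * (u ^+ k / k`!%:R) <= 2 * B - 2 * B / 2 ^+ K.
  by move=> /le_trans; apply; rewrite gerBl divr_ge0 ?mulr_ge0 ?exprn_ge0.
elim: K => [|K IH]; first by rewrite big_nil expr0 divr1 subrr.
rewrite big_nat_recr//=.
have AK : A * (u ^+ K / K`!%:R) <= B / 2 ^+ K.
  rewrite ler_pdivlMr ?exprn_gt0// mulrA mulrAC.
  rewrite ler_pdivrMr ?ltr0n ?fact_gt0//.
  by rewrite -mulrA -exprMn [u * 2]mulrC.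
have -> : 2 * B - 2 * B / 2 ^+ K.+1 = 2 * B - 2 * B / 2 ^+ K + B / 2 ^+ K.
  have : (2 : R) ^+ K != 0 by rewrite expf_neq0.
  by rewrite exprS => ?; field.
exact: lerD.
Qed.

(* With [0 <= y] the conjugate of [exp_reparam phi] is the supremum of
   [k * ln s - phi s] over [s = expR y >= 1]. *)
Lemma exprn_expR_young_conjugate phi t k :
  finite_conjugate phi -> 0 <= t ->
  t ^+ k * expR (- young_conjugate phi t) <=
  k`!%:R * expR (- young_conjugate (exp_reparam phi) k%:R).
Proof.
move=> phi_fin t0.
rewrite [in leRHS]expRN ler_pdivlMr ?expR_gt0//.
apply: expR_young_conjugate_le => [|y y0].
  by rewrite mulr_ge0 ?expR_ge0 ?exprn_ge0.
set u := t * expR y.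
have u0 : 0 <= u by rewrite mulr_ge0 ?expR_ge0.
have uP : u - phi (expR y) <= young_conjugate phi t.
  by apply: young_conjugate_ge; rewrite ?expR_ge0.
(* By [uP] the two occurrences of [phi (expR y)] cancel, leaving only [u ^ k <= k! * expR u]. *)
apply: (@le_trans _ _ (u ^+ k * expR (- u))).
  rewrite exprMn -expRM_natl -!mulrA -!expRD ler_wpM2l ?exprn_ge0// ler_expR.
  by rewrite /exp_reparam; lra.
by rewrite expRN ler_pdivrMr ?expR_gt0// exprn_le_fact_expR.
Qed.

(** In the application [A] is the modulus of a derivative at x, [t] the Euclidean norm of x, [u] the
    modulus of its largest coordinate and [b] a power of 2. [M] is chosen before all of them, so the
    bound is uniform. *)
Lemma le_expR_young_conjugate phi phi' (b c : R) :
  (forall x y, 0 <= x -> x <= y -> phi' x <= phi' y) ->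
  finite_conjugate phi -> 0 <= b ->
  (forall s, 0 <= s -> phi (b * s) <= phi' s + c) ->
  exists2 M, 0 < M & forall t u A N, 0 <= A -> 0 <= u -> 0 <= t ->
    2 * t <= b * u ->
    (forall k, u ^+ k * A <=
       N * (k`!%:R * expR (- young_conjugate (exp_reparam phi) k%:R))) ->
    A <= M * N * expR (- young_conjugate phi' t).
Proof.
move=> phi'_nd phi_fin b0 phi_phi'.
(* The second entry serves the [s] with [b * s < 1], where the dilation hypothesis says nothing
   about [phi 1]. *)
pose c' := Num.max c (phi 1 - phi' 0).
exists (2 * expR c'); first by rewrite mulr_gt0 ?expR_gt0.
move=> t u A N A0 u0 t0 tu AN.
have psi_fin := finite_conjugate_exp_reparam phi_fin.
have N0 : 0 <= N.
  have := AN 0%N; rewrite expr0 mul1r => /(le_trans A0).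
  by rewrite pmulr_lge0// mulr_gt0 ?expR_gt0.
rewrite expRN ler_pdivlMr ?expR_gt0//.
apply: expR_young_conjugate_le => // s s0.
(* The conjugate of [exp_reparam phi] only sees arguments [r >= 1]. *)
pose r := Num.max 1 (b * s).
have r1 : 1 <= r by rewrite le_max lexx.
have r0 : 0 < r by exact: lt_le_trans r1.
have phir : phi r <= phi' s + c'.
  rewrite /r; have [_|_] := leP 1 (b * s).
    by apply: le_trans (phi_phi' s s0) _; rewrite lerD2l le_max lexx.
  rewrite -lerBlDl; apply: (@le_trans _ _ (phi 1 - phi' 0)).
    by rewrite lerB// phi'_nd.
  by rewrite le_max lexx orbT.
rewrite expRB mulrA ler_pdivrMr ?expR_gt0// -!mulrA.
apply: expR_le_of_powers => //; first exact: mulr_ge0.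
move=> k.
(* The 2 demanded by the summation over powers is paid for by [2 * t <= b * u]. *)
have tsur : 2 * (t * s) <= u * r.
  apply: (@le_trans _ _ (u * (b * s))).
    by rewrite mulrA mulrA ler_wpM2r// [u * b]mulrC.
  by rewrite ler_wpM2l// le_max lexx orbT.
apply: (@le_trans _ _ (A * (u * r) ^+ k)).
  by rewrite ler_wpM2l// lerXn2r// nnegrE ?mulr_ge0// ltW.
have psir : k%:R * ln r - phi r <= young_conjugate (exp_reparam phi) k%:R.
  have := young_conjugate_ge k%:R psi_fin (ln_ge0 r1).
  by rewrite /exp_reparam lnK.
have : expR (- young_conjugate (exp_reparam phi) k%:R) * r ^+ k <=
       expR c' * expR (phi' s).
  rewrite -[r in r ^+ k]lnK ?posrE// -expRM_natl -!expRD ler_expR.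
  lra.
have kN : 0 <= N * k`!%:R by rewrite mulr_ge0.
move=> /(ler_wpM2l kN) psik.
have := ler_wpM2r (exprn_ge0 k (ltW r0)) (AN k); rewrite exprMn.
by move: psik; set E := expR (- _); lra.
Qed.


End YoungConjugate.

(** * Comparison of inductive limit topologies *)

Section InductiveLimitComparison.
Context {K : numFieldType} {V : lmodType K}.

Lemma continuous_inclusion_seminorm {R : realType} (E E' : set V)
    (p p' : nat -> V -> \bar R) (M : R) :
  E `<=` E' -> 0 < M ->
  (forall m h (N : R), (p m h <= N%:E)%E -> (p' m h <= (M * N)%:E)%E) ->
  continuous_inclusion E (seminorm_topology E p) (seminorm_topology E' p').
Proof.
move=> EE' M0 pp' U [UE' Uopen]; split=> [f []//|f [Uf Ef]].
have [m [e [e0 eU]]] := Uopen f Uf.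
(* The estimate is non-strict; halving turns its outcome [e / 2] into a strict bound by [e]. *)
exists m, (e / (2 * M)); split; first by rewrite divr_gt0 ?mulr_gt0.
move=> g Eg pg; split=> //; apply: eU => [|k km]; first exact: EE'.
apply: le_lt_trans (pp' _ _ _ (ltW (pg k km))) _; rewrite lte_fin.
have -> : M * (e / (2 * M)) = e / 2 by field; rewrite gt_eqF.
by rewrite ltr_pdivrMr// ltr_pMr// ltr1n.
Qed.

(** The limit depends only on the union and on the locally convex topologies making all inclusions
    continuous; composing inclusions shows that mutually cofinal systems share both. *)
Lemma inductive_limit_topology_eq (E E' : nat -> set V)
    (T T' : nat -> set_system V) :
  (forall nu, exists2 mu, E nu `<=` E' mu &
     continuous_inclusion (E nu) (T nu) (T' mu)) ->
  (forall nu, exists2 mu, E' nu `<=` E mu &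
     continuous_inclusion (E' nu) (T' nu) (T mu)) ->
  \bigcup_nu E nu = \bigcup_nu E' nu /\
  inductive_limit_topology E T = inductive_limit_topology E' T'.
Proof.
have transfer (F F' : nat -> set V) (S S' : nat -> set_system V) :
    (forall nu, exists2 mu, F nu `<=` F' mu &
       continuous_inclusion (F nu) (S nu) (S' mu)) ->
    \bigcup_nu F nu `<=` \bigcup_nu F' nu /\
    forall L, (forall nu, continuous_inclusion (F' nu) (S' nu) L) ->
              forall nu, continuous_inclusion (F nu) (S nu) L.
  move=> FF'; split=> [f [nu _ Ff]|L F'L nu U LU].
    by have [mu FF'mu _] := FF' nu; exists mu => //; exact: FF'mu.
  have [mu FF'mu /(_ _ (F'L mu U LU))] := FF' nu.
  by rewrite -setIA (setIidr FF'mu).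
move=> /transfer[EE' LE'E] /transfer[E'E LEE'].
have EE'_eq : \bigcup_nu E nu = \bigcup_nu E' nu by apply/seteqP.
split=> //; rewrite /inductive_limit_topology EE'_eq; congr smallest.
congr bigcup; apply/seteqP; split=> L [Llc Linc]; split=> //.
  exact: LEE'.
exact: LE'E.
Qed.

End InductiveLimitComparison.

(** * Comparison of the two families of norms *)

Section PointwiseBounds.
Context {R : realType} {n : nat}.
Implicit Types (f : 'rV[R]_n -> R[i]^o) (x : 'rV[R]_n) (w phi : R -> R).

Lemma G_norm_leP w m f (N : R) :
  (G_norm w m f <= N%:E)%E <->
  forall x (a b : multi_index), (mi_size a <= m)%N ->
    `|monomial x b| * Normc.normc (D a f x) <=
    N * ((mi_size b)`!%:R * expR (- w (mi_size b)%:R)).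
Proof.
have normcE x (a b : multi_index) :
    Normc.normc ((monomial x b)%:C%C * D a f x) =
    `|monomial x b| * Normc.normc (D a f x).
  by rewrite Normc.normcM /= expr0n/= addr0 sqrtr_sqr.
have den0 (k : nat) : 0 < k`!%:R * expR (- w k%:R).
  by rewrite mulr_gt0 ?expR_gt0// ltr0n fact_gt0.
split=> [fN x a b am|fN].
  rewrite -normcE -ler_pdivrMr// -lee_fin; apply: le_trans fN.
  by apply: ereal_sup_ubound; exists x, a, b.
apply: ge_ereal_sup => _ [x [a [b [am ->]]]].
by rewrite lee_fin ler_pdivrMr// normcE fN.
Qed.

Lemma GS_norm_leP w m f (N : R) :
  (GS_norm w m f <= N%:E)%E <->
  forall x (a : multi_index), (mi_size a <= m)%N ->
    Normc.normc (D a f x) <= N * expR (- w (euclidean_norm x)).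
Proof.
split=> [fN x a am|fN].
  rewrite -ler_pdivrMr ?expR_gt0// -lee_fin; apply: le_trans fN.
  by apply: ereal_sup_ubound; exists x, a.
apply: ge_ereal_sup => _ [x [a [am ->]]].
by rewrite lee_fin ler_pdivrMr ?expR_gt0// fN.
Qed.

Lemma normc_ge0 (z : R[i]) : 0 <= Normc.normc z.
Proof. by case: z => a b; exact: sqrtr_ge0. Qed.

Lemma norm_coord_le_euclidean x (i : 'I_n) : `|x 0 i| <= euclidean_norm x.
Proof.
rewrite -sqrtr_sqr ler_wsqrtr// (bigD1 i)//= lerDl sumr_ge0// => j _.
exact: sqr_ge0.
Qed.

Lemma norm_monomial_le x (b : multi_index) :
  `|monomial x b| <= euclidean_norm x ^+ mi_size b.
Proof.
rewrite normr_prod -prodrXr; apply: ler_prod => i _.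
by rewrite normr_ge0 normrX lerXn2r ?nnegrE ?norm_coord_le_euclidean ?sqrtr_ge0.
Qed.

Lemma euclidean_norm_le_coord x : (0 < n)%N ->
  exists i, euclidean_norm x <= n%:R * `|x 0 i|.
Proof.
move=> n0; pose i := [arg max_(i > Ordinal n0) `|x 0 i|]%O.
have iP j : `|x 0 j| <= `|x 0 i|.
  by rewrite /i; case: arg_maxP => // k _; apply.
exists i; rewrite -[leRHS]ger0_norm ?mulr_ge0// -sqrtr_sqr ler_wsqrtr//.
apply: (@le_trans _ _ (\sum_(j < n) `|x 0 i| ^+ 2)).
  apply: ler_sum => j _; rewrite -[x 0 j ^+ 2]ger0_norm ?sqr_ge0// normrX.
  by rewrite lerXn2r ?nnegrE.
(* Bounding [n] by [n ^ 2] avoids a square root in the constant. *)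
rewrite sumr_const card_ord exprMn -[leLHS]mulr_natl ler_wpM2r ?sqr_ge0//.
by rewrite -natrX ler_nat -{1}(expn1 n) leq_pexp2l.
Qed.

Definition single_index (i : 'I_n) (k : nat) : @multi_index n :=
  [ffun j => if j == i then k else 0%N].

Lemma mi_size_single i k : mi_size (single_index i k) = k.
Proof.
rewrite /mi_size (bigD1 i)//= ffunE eqxx big1 ?addn0// => j /negPf ji.
by rewrite ffunE ji.
Qed.

Lemma monomial_single x i k : monomial x (single_index i k) = x 0 i ^+ k.
Proof.
rewrite /monomial (bigD1 i)//= ffunE eqxx big1 ?mulr1// => j /negPf ji.
by rewrite ffunE ji expr0.
Qed.

Lemma GS_norm_G_norm phi m f (N : R) : finite_conjugate phi ->
  (GS_norm (young_conjugate phi) m f <= N%:E)%E ->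
  (G_norm (young_conjugate (exp_reparam phi)) m f <= (1 * N)%:E)%E.
Proof.
move=> phi_fin /GS_norm_leP fN; apply/G_norm_leP => x a b am; rewrite mul1r.
have e0 : 0 <= euclidean_norm x by exact: sqrtr_ge0.
have N0 : 0 <= N.
  rewrite -(pmulr_lge0 _ (expR_gt0 (- young_conjugate phi (euclidean_norm x)))).
  exact: le_trans (normc_ge0 _) (fN x a am).
apply: le_trans (ler_pM _ _ (norm_monomial_le x b) (fN x a am)) _ => //.
  exact: normc_ge0.
by rewrite mulrCA ler_wpM2l// exprn_expR_young_conjugate.
Qed.

(** At each x only the pure powers of its largest coordinate are tested, and [2 * n <= 2 ^ j] makes
    the dilation cover both the loss [n] and the summation factor 2. *)
Lemma G_norm_GS_norm phi phi' (c : R) (j : nat) : (0 < n)%N ->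
  (forall s t : R, 0 <= s -> s <= t -> phi' s <= phi' t) ->
  finite_conjugate phi -> (2 * n <= 2 ^ j)%N ->
  (forall s, 0 <= s -> phi (2 ^+ j * s) <= phi' s + c) ->
  exists2 M, 0 < M & forall m f (N : R),
    (G_norm (young_conjugate (exp_reparam phi)) m f <= N%:E)%E ->
    (GS_norm (young_conjugate phi') m f <= (M * N)%:E)%E.
Proof.
move=> n0 phi'_nd phi_fin nj phi_phi'.
have [M M0 MP] := le_expR_young_conjugate phi'_nd phi_fin
  (exprn_ge0 j (ler0n R 2)) phi_phi'.
exists M => // m f N /G_norm_leP fN; apply/GS_norm_leP => x a am.
have [i xi] := euclidean_norm_le_coord x n0.
apply: MP (normc_ge0 _) (normr_ge0 (x 0 i)) (sqrtr_ge0 _) _ _.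
  apply: (@le_trans _ _ (2 * (n%:R * `|x 0 i|))); first by rewrite ler_wpM2l.
  by rewrite mulrA ler_wpM2r// -natrM -natrX ler_nat.
move=> k; have := fN x a (single_index i k) am.
by rewrite mi_size_single monomial_single normrX.
Qed.

End PointwiseBounds.

Lemma bounded_of_lt_pinfty {R : realType} (z : \bar R) :
  (z < +oo)%E -> exists N : R, (z <= N%:E)%E.
Proof.
by case: z => [N _|//|_]; [exists N|exists 0; rewrite leNye].
Qed.

Lemma iterated_doubling {R : realType} (phi : nat -> R -> R)
    (i3 : forall m, exists2 a : R, 0 < a &
      forall x : R, 0 <= x -> phi m (2 * x) <= phi m.+1 x + a) m j :
  exists c, forall s, 0 <= s -> phi m (2 ^+ j * s) <= phi (m + j)%N s + c.
Proof.
elim: j => [|j [c cP]].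
  by exists 0 => s _; rewrite addn0 expr0 mul1r addr0.
have [a _ aP] := i3 (m + j)%N; exists (a + c) => s s0.
rewrite exprSr -mulrA addnS addrA.
apply: le_trans (cP _ _) _; first by rewrite mulr_ge0.
by rewrite lerD2r aP.
Qed.

Theorem theorem4 (R : realType) (n : nat) (phi : nat -> R -> R)
    (hn : (0 < n)%N)
    (phi_nondecreasing : forall m (x y : R),
      0 <= x -> x <= y -> phi m x <= phi m y)
    (phi_continuous : forall m, {within `[0, +oo[, continuous (phi m)})
    (phi_convex : forall m,
      convex_function (`[0, +oo[%classic : set R) (phi m))
    (i1 : forall m, phi m x / x @[x --> +oo] --> +oo)
    (i2 : forall m (A : R), 0 < A -> exists2 C : R, 0 < C &
      forall x : R, 0 <= x -> phi m x + A * ln (1 + x) <= phi m.+1 x + C)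
    (i3 : forall m, exists2 a : R, 0 < a &
      forall x : R, 0 <= x -> phi m (2 * x) <= phi m.+1 x + a) :
  G_Psi n phi = GS_Phi n phi /\ G_Psi_topology n phi = GS_Phi_topology n phi.
Proof.
have phi_fin nu := finite_conjugate_superlinear (@phi_nondecreasing nu) (i1 nu).
apply: inductive_limit_topology_eq => nu.
  (* A crude choice: [j < 2 ^ j] gives the required [2 * n <= 2 ^ j]. *)
  pose j := (2 * n)%N.
  have [c cP] := iterated_doubling i3 nu j.
  have [M M0 MP] := G_norm_GS_norm hn (@phi_nondecreasing (nu + j)%N)
    (phi_fin nu) (ltnW (ltn_expl j (ltnSn 1))) cP.
  have GGS : G (Psi_conj phi nu) `<=` @GS R n (Phi_conj phi (nu + j)).
    move=> f Gf m _; have [Cf fin] := Gf m I; split=> //.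
    have [N /MP] := bounded_of_lt_pinfty fin.
    by move=> /le_lt_trans; apply; rewrite ltry.
  exists (nu + j)%N => //; exact: continuous_inclusion_seminorm M0 MP.
have GSG : GS (Phi_conj phi nu) `<=` @G R n (Psi_conj phi nu).
  move=> f GSf m _; have [Cf fin] := GSf m I; split=> //.
  have [N /(GS_norm_G_norm (phi_fin nu))] := bounded_of_lt_pinfty fin.
  by move=> /le_lt_trans; apply; rewrite ltry.
(* No dilation occurs in this direction, so the index stays the same and the constant is 1. *)
exists nu => //; apply: continuous_inclusion_seminorm GSG ltr01 _ => m h N.
exact: GS_norm_G_norm.
Qed.
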